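(* For each $i\in\{1,\dots,n\}$ let $(X_{i,1},Y_{i,1}),\dots,(X_{i,k},Y_{i,k})$ be i.i.d. random vectors in $\mathbb R^2$ with common density $f_i$ satisfying $f_i\in L_\infty(\mathbb R^2)$, $\|f_i\|_{L_\infty(B((0,0),R))}\le C_0$, and $f_i=0$ outside $B((0,0),R)$, where $R,C_0>0$; the families for different $i$ are mutually independent. For $(x,y)\in B((0,0),R)$ let $Z^i(x,y)=\min_{1\le j\le k}\sqrt{(X_{i,j}-x)^2+(Y_{i,j}-y)^2}$ and $\overline Z_n(x,y)=\frac1n\sum_{i=1}^nZ^i(x,y)$. Then for every $\eta>0$ and $\delta\in(0,1)$, if $n>\frac{2R^2}{\eta^2}\ln\frac2\delta$, $$\Pr\Big[\min_{(x,y)\in B((0,0),R)}\overline Z_n(x,y)\ge\frac{1}{4\pi RC_0(k+1)}-\eta\Big]>1-\delta.$$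
   Context: $B((0,0),R)$ denotes the closed Euclidean disk of radius $R$ centered at the origin. *)

(* Defs.v *)
From HB Require Import structures.
From mathcomp Require Import all_boot all_order all_algebra.
From mathcomp Require Import all_classical all_reals all_analysis.
Set Implicit Arguments. Unset Strict Implicit. Unset Printing Implicit Defensive.
Import Order.TTheory GRing.Theory Num.Theory.
Import numFieldNormedType.Exports.
Local Open Scope classical_set_scope.
Local Open Scope ring_scope.

Definition disk (R : realType) (r : R) : set (R * R) :=
  [set z | z.1 ^+ 2 + z.2 ^+ 2 <= r ^+ 2].

Definition dist2 (R : realType) (p q : R * R) : R :=
  Num.sqrt ((p.1 - q.1) ^+ 2 + (p.2 - q.2) ^+ 2).

Definition kmin (R : realType) (k : nat) (k0 : (0 < k)%N) (d : 'I_k -> R) : R :=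
  \big[Num.min/ d (Ordinal k0)]_(j < k) d j.

Definition leb2 (R : realType) := ((@lebesgue_measure R) \x (@lebesgue_measure R))%E.

Definition mutually_independent (d : measure_display) (T : measurableType d)
  (R : realType) (P : probability T R) (I : finType) (V : I -> T -> R * R) :=
  forall (J : {set I}) (A : I -> set (R * R)),
    (forall i, measurable (A i)) ->
    P (\bigcap_(i in [set i | i \in J]) (V i @^-1` A i)) =
    (\prod_(i in J) P (V i @^-1` A i))%E.

(* Main.v *)
(**
Write [t = 1 / (4 pi Rad C0 (k + 1))]; only the case [eta < t] is not trivial.
A pointwise Hoeffding bound does not control the minimum over the disk, so the
disk is covered by square cells of half-side [h / 3], where [C0 (2 h)^2 = 1 / (4 k)].
Since [4 C0 Rad^2 >= 1] (total mass) and [pi >= 3], one has [t <= h / 3].  If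
the mean distance is below [t] at some point, then at least half of the
families have a sample in the square of half-side [h] around a nearby cell
centre.  Each family has this property with probability at most 1/4, so by an
exponential moment bound half of them do so with probability at most
[(7/8)^n <= exp (- n / 8)].  The condition on [n] with [eta < t] makes [n] so
large that this beats both the number of cells and [delta].
*)
Require Import Defs.
From HB Require Import structures.
From mathcomp Require Import all_boot all_order all_algebra.
From mathcomp Require Import all_classical all_reals all_analysis.
From mathcomp Require Import measurable_realfun.
From mathcomp Require Import ring lra zify.
Import Order.TTheory GRing.Theory Num.Theory.
Import numFieldNormedType.Exports.
Local Open Scope classical_set_scope.
Local Open Scope ring_scope.

(** * A lower bound for pi *)

Lemma sin_le_id (R : realType) (x : R) : 0 <= x -> sin x <= x.
Proof.
move=> x0.
have [|c _] := @MVT_segment R sin cos 0 x x0 (fun y _ => is_derive_sin y).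
  by apply: continuous_subspaceT => y; exact: continuous_sin.
rewrite sin0 !subr0 => ->.
by rewrite -[leRHS]mul1r ler_wpM2r// cos_le1.
Qed.

(** The double angle formula gives [s = 1 - 2 s^2] for [s = sin (pi / 6)], whose only positive root
    is 1/2. *)
Lemma sin_pi6 (R : realType) : sin (pi / 6) = 2^-1 :> R.
Proof.
have pi0 := @pi_gt0 R.
have s0 : 0 < sin (pi / 6 : R) by apply: sin_gt0_pi; apply/andP; split; lra.
have e : sin (pi / 6 : R) = cos (pi / 6 *+ 2).
  rewrite -cosBpihalf -cosN; congr cos; lra.
rewrite cos_mulr2n in e.
have := cos2Dsin2 (pi / 6 : R).
nra.
Qed.

Lemma pi_ge3 (R : realType) : 3 <= pi :> R.
Proof.
have := @sin_le_id R (pi / 6).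
have := @pi_gt0 R.
rewrite sin_pi6 => ? /(_ _)/wrap[]; lra.
Qed.

(** * Lipschitz bounds for the distance and for the minimum over samples *)

Section dist2.
Context {R : realType}.
Implicit Types p q v : R * R.

Lemma dist2_ge0 p q : 0 <= dist2 p q.
Proof. exact: sqrtr_ge0. Qed.

Lemma le_dist2_fst p q : `|p.1 - q.1| <= dist2 p q.
Proof. by rewrite -sqrtr_sqr ler_wsqrtr// lerDl sqr_ge0. Qed.

Lemma le_dist2_snd p q : `|p.2 - q.2| <= dist2 p q.
Proof. by rewrite -sqrtr_sqr ler_wsqrtr// lerDr sqr_ge0. Qed.

(** After squaring, the cross terms [a x + b y] are at most [D (|x| + |y|)], since [D] dominates
    [|a|] and [|b|]. *)
Lemma dist2_lip v p q :
  dist2 v p <= dist2 v q + (`|q.1 - p.1| + `|q.2 - p.2|).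
Proof.
have aD := le_dist2_fst v q; have bD := le_dist2_snd v q.
have D0 := dist2_ge0 v q.
have sD : dist2 v q ^+ 2 = (v.1 - q.1) ^+ 2 + (v.2 - q.2) ^+ 2.
  by rewrite sqr_sqrtr// addr_ge0// sqr_ge0.
rewrite [leLHS]/dist2.
have -> : v.1 - p.1 = (v.1 - q.1) + (q.1 - p.1) by ring.
have -> : v.2 - p.2 = (v.2 - q.2) + (q.2 - p.2) by ring.
move: (dist2 v q) (v.1 - q.1) (v.2 - q.2) (q.1 - p.1) (q.2 - p.2) D0 sD aD bD.
move=> D a b x y D0 sD aD bD.
have x0 := normr_ge0 x; have y0 := normr_ge0 y.
rewrite -[leRHS]ger0_norm; last by rewrite !addr_ge0.
rewrite -sqrtr_sqr ler_wsqrtr//.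
have ax : a * x <= D * `|x|.
  by rewrite (le_trans (ler_norm _))// normrM ler_wpM2r.
have by_ : b * y <= D * `|y|.
  by rewrite (le_trans (ler_norm _))// normrM ler_wpM2r.
have := real_normK (num_real x); have := real_normK (num_real y).
move: `|x| `|y| x0 y0 ax by_ => x' y' x0 y0 ax by_ sy sx.
have := mulr_ge0 x0 y0.
rewrite !sqrrD sD sx sy; lra.
Qed.

End dist2.

Section kmin.
Context {R : realType} {k : nat} (k0 : (0 < k)%N).
Implicit Types d : 'I_k -> R.

Lemma kmin_le d j : kmin k0 d <= d j.
Proof. exact: bigmin_le_cond. Qed.

Lemma kmin_attained d : exists j, kmin k0 d = d j.
Proof.
rewrite /kmin; elim/big_ind: _ => [|x y [i ->] [j ->]|j _].
- by exists (Ordinal k0).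
- by case: (leP (d i) (d j)) => _; [exists i | exists j].
- by exists j.
Qed.

End kmin.

Lemma kmin_lip (R : realType) k (k0 : (0 < k)%N) (d d' : 'I_k -> R) (e : R) :
  (forall j, d j <= d' j + e) -> kmin k0 d <= kmin k0 d' + e.
Proof.
move=> dd'; have [j ->] := kmin_attained k0 d'.
exact: le_trans (kmin_le k0 d j) (dd' j).
Qed.

(** * Measurability, including that of an event ranging over the whole disk *)

Lemma measurable_kmin d (T : measurableType d) (R : realType) k
    (k0 : (0 < k)%N) (D : 'I_k -> T -> R) :
  (forall j, measurable_fun setT (D j)) ->
  measurable_fun setT (fun w => kmin k0 (D^~ w)).
Proof.
move=> mD; rewrite /kmin; elim: (index_enum _) => [|j s ih].
  by under eq_fun do rewrite big_nil; exact: mD.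
by under eq_fun do rewrite big_cons; exact: measurable_minr.
Qed.

Lemma measurable_dist2 d (T : measurableType d) (R : realType) (X Y : T -> R)
    (p : R * R) :
  measurable_fun setT X -> measurable_fun setT Y ->
  measurable_fun setT (fun w => dist2 (X w, Y w) p).
Proof.
move=> mX mY.
have msqrt : measurable_fun [set: R] (Num.sqrt : R -> R).
  by apply: continuous_measurable_fun; exact: sqrt_continuous.
apply: (measurableT_comp msqrt).
by apply: measurable_funD; apply: measurable_funX; exact: measurable_funB.
Qed.

(** Truncation rounds nonnegative numbers down, and negative ones reduce to these by symmetry, so
    the absolute value never grows. *)
Lemma grid_approx_toward0 {R : realType} (x : R) (m : nat) :
  exists a : int, `|a%:~R / m.+1%:R| <= `|x| /\
    `|a%:~R / m.+1%:R - x| <= m.+1%:R^-1.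
Proof.
have m0 : 0 < m.+1%:R :> R by rewrite ltr0n.
wlog x0 : x / 0 <= x => [H|].
  have [/H//|x0] := leP 0 x.
  have [|a [a1 a2]] := H (- x); first by rewrite oppr_ge0 ltW.
  exists (- a); rewrite mulrNz mulNr normrN -(normrN x); split => //.
  by rewrite -opprD normrN -[x in _ + x]opprK.
have xm0 : 0 <= x * m.+1%:R by rewrite mulr_ge0// ltW.
have /andP[t1 t2] := truncn_itv xm0.
exists (Num.trunc (x * m.+1%:R))%:Z.
rewrite -pmulrn -ler_pdivrMr// in t1 *.
have e0 : 0 <= (Num.trunc (x * m.+1%:R))%:R / m.+1%:R :> R.
  by rewrite divr_ge0// ltW.
split; first by rewrite !ger0_norm.
rewrite distrC ger0_norm ?subr_ge0//.
rewrite lerBlDl -[X in _ + X]mul1r -mulrDl natr1 ler_pdivlMr//.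
exact: ltW.
Qed.

(* By the Lipschitz hypothesis it is enough to look at rational points;
   rounding coordinates towards 0 keeps a point of the disk in the disk. *)
Lemma measurable_forall_disk d (T : measurableType d) (R : realType)
    (F : R * R -> T -> R) (r c : R) :
  (forall p, measurable_fun setT (F p)) ->
  (forall w p q, F q w <= F p w + (`|p.1 - q.1| + `|p.2 - q.2|)) ->
  measurable [set w | forall p, disk r p -> c <= F p w].
Proof.
move=> mF lipF.
pose g (u : int * int * nat) : R * R :=
  (u.1.1%:~R / u.2.+1%:R, u.1.2%:~R / u.2.+1%:R).
rewrite (_ : mkset _ = ~` \bigcup_u [set w | disk r (g u) /\ F (g u) w < c]).
  apply: measurableC; apply: countable_bigcupT_measurable => // u.
  have [du|ndu] := pselect (disk r (g u)); last first.
    by rewrite (_ : mkset _ = set0)//; apply/seteqP; split => // w [].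
  rewrite (_ : mkset _ = setT `&` [set w | F (g u) w < c]); last first.
    by apply/seteqP; split => w [].
  have := measurable_fun_ltr (mF (g u)) (@measurable_cst _ _ T R setT c).
  by move=> /(_ measurableT [set true] I).
apply/seteqP; split => w /=.
  by move=> H [u _ [/H]]; rewrite leNgt => /negP.
move=> H p dp; rewrite leNgt; apply/negP => Fc.
have e0 : 0 < c - F p w by rewrite subr_gt0.
(* Each coordinate is off by at most [1 / (m + 1)]; this [m] keeps the total below the gap
   [c - F p w]. *)
pose m := Num.trunc (2 / (c - F p w)).
have hm : 2 / m.+1%:R < c - F p w.
  rewrite ltr_pdivrMr ?ltr0n// mulrC -ltr_pdivrMr//; exact: truncnS_gt.
have [a [a1 a2]] := grid_approx_toward0 p.1 m.
have [b [b1 b2]] := grid_approx_toward0 p.2 m.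
apply: H; exists (a, b, m) => //; split.
  rewrite /disk/= (le_trans _ dp)//.
  by apply: lerD; rewrite -[leLHS]real_normK ?num_real//
    -[leRHS]real_normK ?num_real// lerXn2r ?nnegrE.
have := lipF w p (g (a, b, m)); rewrite /g/= (distrC p.1) (distrC p.2).
by move: (m.+1%:R^-1) a2 b2 hm Fc => M; lra.
Qed.

(** * Squares and their mass under a bounded density *)

Definition square {R : realType} (g : R * R) (h : R) : set (R * R) :=
  `[g.1 - h, g.1 + h]%classic `*` `[g.2 - h, g.2 + h]%classic.

Lemma squareP {R : realType} (g z : R * R) (h : R) :
  square g h z <-> `|z.1 - g.1| <= h /\ `|z.2 - g.2| <= h.
Proof. by rewrite /square/= !in_itv/= !ler_distl. Qed.

Lemma measurable_square {R : realType} (g : R * R) (h : R) :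
  measurable (square g h).
Proof. exact: measurableX. Qed.

Lemma leb2_square {R : realType} (g : R * R) (h : R) : 0 <= h ->
  leb2 (square g h) = (4 * h ^+ 2)%:E.
Proof.
move=> h0; rewrite /leb2 product_measure1E//=.
rewrite !lebesgue_measure_itv/= !lte_fin.
have [e|hh] := eqVneq h 0.
  by rewrite e !subr0 !addr0 !ltxx mule0 expr0n mulr0.
have hp : 0 < h by rewrite lt_neqAle eq_sym hh.
rewrite !ltrBlDr -!addrA !ltrDl !addr_gt0// -!EFinD -EFinM; congr EFin; ring.
Qed.

(** Pass to [|f|], which is almost everywhere at most [C]: by hypothesis on the disk, and because
    [f] vanishes off it. *)
Lemma integral_density_le (R : realType) (f : R * R -> R) (r C : R)
    (Q : set (R * R)) :
  0 <= C -> measurable_fun setT f ->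
  {ae @leb2 R, forall z, disk r z -> `|f z| <= C} ->
  (forall z, ~ disk r z -> f z = 0) -> measurable Q ->
  (\int[@leb2 R]_(z in Q) (f z)%:E <= C%:E * leb2 Q)%E.
Proof.
pose RR : measurableType _ := (measurableTypeR R * measurableTypeR R)%type.
move=> C0 mf fC f0 mQ.
have mQ' : @measurable _ RR Q := mQ.
have mf' : @measurable_fun _ _ RR R setT f := mf.
have mfQ : @measurable_fun _ _ RR (\bar R) Q (EFin \o f).
  by apply/measurable_EFinP; exact: measurable_funTS.
rewrite (le_trans (lee_abs _))//.
rewrite (le_trans (le_abse_integral _ mQ' mfQ))//.
rewrite /leb2 in fC *; rewrite -integral_cst//.
apply: ae_ge0_le_integral => //.
- exact: measurableT_comp.
- apply: (@filterS _ _ (ae_filter_ringOfSetsType _) _ _ _ fC) => z fCz _ /=.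
  rewrite lee_fin; have [/fCz//|/f0 ->] := pselect (disk r z).
  by rewrite normr0.
Qed.

(** The square contains the disk. With total mass 1 this will give [4 C0 Rad^2 >= 1]. *)
Lemma integral_density_square (R : realType) (f : R * R -> R) (r : R) :
  (forall z, ~ disk r z -> f z = 0) -> 0 <= r ->
  (\int[@leb2 R]_z (f z)%:E = \int[@leb2 R]_(z in square (0, 0)%R r) (f z)%:E)%E.
Proof.
move=> f0 r0; rewrite [RHS]integral_mkcond; apply: eq_integral => z _.
rewrite patchE; case: ifPn => // /negP zr; rewrite f0// => dz; apply: zr.
rewrite inE; apply/squareP; move: dz; rewrite /disk/= !subr0 => dz.
by rewrite !ler_norml; split; apply/andP; split; nra.
Qed.

(** * Exponential moment bound for the number of families hit *)

(** As in Markov's inequality, integrate [K \1_A <= \sum_i c_i \1_(B_i)]. *)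
Lemma weighted_union_bound d (T : measurableType d) (R : realType)
    (P : probability T R) (I : finType) (c : I -> R) (B : I -> set T)
    (A : set T) (K : R) :
  0 <= K -> (forall i, 0 <= c i) -> measurable A ->
  (forall i, measurable (B i)) ->
  (forall w, A w -> K <= \sum_i c i * \1_(B i) w) ->
  (K%:E * P A <= \sum_i (c i)%:E * P (B i))%E.
Proof.
move=> K0 c0 mA mB AB.
have mc (r : R) (C : set T) : measurable C ->
    measurable_fun setT ((fun w => (r * \1_C w)%:E) : T -> \bar R).
  by move=> mC; apply/measurable_EFinP; apply: measurable_funM => //;
    exact: measurable_indic.
have intc (r : R) (C : set T) : 0 <= r -> measurable C ->
    (\int[P]_w (r * \1_C w)%:E = r%:E * P C)%E.
  move=> r0 mC; under eq_integral do rewrite EFinM.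
  rewrite ge0_integralZl//.
  - by rewrite integral_indic// setIT.
  - by apply/measurable_EFinP; exact: measurable_indic.
rewrite -intc//; under eq_bigr do rewrite -intc//.
rewrite -ge0_integral_sum//; last 2 first.
- by move=> i; exact: mc.
- by move=> i w _; rewrite lee_fin mulr_ge0.
apply: ge0_le_integral => //.
- by move=> w _; rewrite lee_fin mulr_ge0.
- exact: mc.
- by apply: emeasurable_sum => i; exact: mc.
move=> w _; rewrite sumEFin lee_fin.
have [Aw|nAw] := pselect (A w).
  by rewrite indicE mem_set// mulr1 AB.
by rewrite indicE memNset// mulr0 sumr_ge0// => i _; rewrite mulr_ge0.
Qed.

(** Distributivity, with [None] standing for the summand 1 and [Some j] for [F i j]. *)
Lemma prod_sum_option {R : comRingType} {n k} (F : 'I_n -> 'I_k -> R) :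
  \prod_(i < n) (1 + \sum_(j < k) F i j) =
  \sum_(f : {ffun 'I_n -> option 'I_k})
     \prod_(i < n) (if f i is Some j then F i j else 1).
Proof.
rewrite -(bigA_distr_bigA (fun (i : 'I_n) (o : option 'I_k) =>
  if o is Some j then F i j else 1)).
apply: eq_bigr => i _.
rewrite (bigD1 None)//= (reindex_omap Some id); last by case.
by congr (_ + _); apply: eq_bigl => j; rewrite eqxx.
Qed.

Section hits.
Context {d : measure_display} {T : measurableType d} {R : realType}.
Variables (P : probability T R) (n k : nat).
Variable V : 'I_n * 'I_k -> T -> R * R.
Hypothesis mV : forall ij, measurable_fun setT (V ij).
Hypothesis indepV : mutually_independent P V.

(* A term of the expansion is a choice [f]: [f i = Some j] picks the summand
   [3 \1_(V (i, j) \in Q)] of the [i]-th factor, [f i = None] the summand 1. *)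
Let chosen (f : {ffun 'I_n -> option 'I_k}) :=
  [set ij : 'I_n * 'I_k | f ij.1 == Some ij.2]%SET.

Let hit (Q : set (R * R)) (f : {ffun 'I_n -> option 'I_k}) : set T :=
  \bigcap_(ij in [set ij | ij \in chosen f]) (V ij @^-1` Q).

Let weight (f : {ffun 'I_n -> option 'I_k}) : R :=
  \prod_(i < n) (if f i is Some _ then 3 else 1).

Let weight_ge0 f : 0 <= weight f.
Proof. by apply: prodr_ge0 => i _; case: (f i). Qed.

Let measurable_hit Q f : measurable Q -> measurable (hit Q f).
Proof.
move=> mQ; apply: fin_bigcap_measurable => // ij _.
by rewrite -[X in measurable X]setTI; exact: mV.
Qed.

Let weight_indic Q f w : weight f * \1_(hit Q f) w =
  \prod_(i < n) (if f i is Some j then 3 * \1_(V (i, j) @^-1` Q) w else 1).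
Proof.
have [hw|/existsNP[[i j] /not_implyP[]]] := pselect (hit Q f w).
  rewrite indicE mem_set// mulr1; apply: eq_bigr => i _.
  case e : (f i) => [j|//]; rewrite indicE mem_set ?mulr1//.
  by apply: (hw (i, j)); rewrite /= inE/= e.
rewrite /= inE/= => /eqP fi nQ.
rewrite indicE memNset; last by move/(_ (i, j)); apply/not_implyP; rewrite /= inE/= fi.
rewrite mulr0 (bigD1 i)//= fi indicE memNset ?mulr0 ?mul0r//.
Qed.

Let weight_prob Q f q : measurable Q ->
  (forall ij, (P (V ij @^-1` Q) <= q%:E)%E) ->
  ((weight f)%:E * P (hit Q f) <=
   (\prod_(i < n) (if f i is Some j then 3 * q else 1))%:E)%E.
Proof.
move=> mQ Pq.
have mVQ ij : measurable (V ij @^-1` Q).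
  by rewrite -[X in measurable X]setTI; exact: mV.
pose p ij := fine (P (V ij @^-1` Q)).
have pE ij : P (V ij @^-1` Q) = (p ij)%:E by rewrite fineK// fin_num_measure.
rewrite /hit indepV//; under eq_bigr do rewrite pE.
rewrite -(big_morph EFin EFinM erefl) -EFinM lee_fin.
(* Each [i] has at most one chosen [j], so the product over chosen pairs becomes a product over
   [i]. *)
rewrite (_ : \prod_(ij in chosen f) p ij =
  \prod_(i < n) if f i is Some j then p (i, j) else 1); last first.
  transitivity (\prod_(i < n) \prod_(j < k | f i == Some j) p (i, j)).
    by rewrite pair_big_dep/=; apply: eq_big => [[i j]|[i j]]; rewrite ?inE.
  apply: eq_bigr => i _; case: (f i) => [j|]; last by rewrite big_pred0.
  by under eq_bigl do rewrite (inj_eq Some_inj) eq_sym; rewrite big_pred1_eq.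
rewrite -big_split/=; apply: ler_prod => i _; case: (f i) => [j|].
  have p0 : 0 <= p (i, j) by rewrite fine_ge0.
  by rewrite mulr_ge0//= ler_wpM2l// -lee_fin -pE.
by rewrite mulr1 ler01 lexx.
Qed.

(* If at least half of the [i] are hit, then
   [2 ^ n <= 4 ^ #hits <= \prod_i (1 + 3 \sum_j \1_(V (i, j) \in Q g))];
   expanding the product, independence bounds the mean of each term. *)
Lemma prob_half_hit (G : finType) (Q : G -> set (R * R)) (q : R) (A : set T) :
  measurable A -> (forall g, measurable (Q g)) ->
  (forall g ij, (P (V ij @^-1` Q g) <= q%:E)%E) ->
  (forall w, A w -> exists g,
     (n <= 2 * #|[set i : 'I_n | [exists j, V (i, j) w \in Q g]]%SET|)%N) ->
  ((2 ^+ n)%:E * P A <= (#|G|%:R * (1 + 3 * q *+ k) ^+ n)%:E)%E.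
Proof.
move=> mA mQ Pq hA.
(* Indexing by pairs (cell, choice) handles the union over cells and the expansion of the product at
   once. *)
apply: le_trans (@weighted_union_bound _ _ _ P
  (G * {ffun 'I_n -> option 'I_k})%type (fun gf => weight gf.2)
  (fun gf => hit (Q gf.1) gf.2) A (2 ^+ n) _ _ _ _ _) _ => //.
- by move=> gf; exact: measurable_hit.
- move=> w /hA[g hg].
  rewrite -(pair_big predT predT (fun g f => weight f * \1_(hit (Q g) f) w))/=.
  rewrite (bigD1 g)//= -[leLHS]addr0 lerD//; last first.
    by apply: sumr_ge0 => g' _; apply: sumr_ge0 => f _; rewrite mulr_ge0.
  under eq_bigr do rewrite weight_indic.
  rewrite -(prod_sum_option (fun i j => 3 * \1_(V (i, j) @^-1` Q g) w)).
  apply: (@le_trans _ _ (\prod_(i < n)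
    if i \in [set i : 'I_n | [exists j, V (i, j) w \in Q g]]%SET then 4 else 1)).
    rewrite -big_mkcond/= prodr_const (_ : 4 = 2 ^+ 2); last by ring.
    by rewrite -exprM ler_weXn2l// ler1n.
  apply: ler_prod => i _; case: ifPn => [|_]; last first.
    by rewrite ler01 lerDl sumr_ge0// => j _; rewrite mulr_ge0.
  (* A hit [i] has a sample [j] in [Q g], so its factor is at least [1 + 3]. *)
  rewrite inE => /existsP[j Vj]; rewrite ler0n/= (_ : 4 = 1 + 3); last by ring.
  rewrite lerD2l (bigD1 j)//= [X in 3 * X](_ : _ = 1); last first.
    by rewrite indicE /= mem_set// -in_setE.
  by rewrite mulr1 lerDl sumr_ge0// => j' _; rewrite mulr_ge0.
rewrite -(pair_big predT predT (fun g f => (weight f)%:E * P (hit (Q g) f))%E)/=.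
have bound g : (\sum_f (weight f)%:E * P (hit (Q g) f) <=
    ((1 + 3 * q *+ k) ^+ n)%:E)%E.
  apply: (@le_trans _ _ (\sum_(f : {ffun 'I_n -> option 'I_k})
    (\prod_(i < n) if f i is Some j then 3 * q else 1)%:E)%E).
    by apply: lee_sum => f _; exact: weight_prob.
  rewrite sumEFin -(prod_sum_option (fun _ _ => 3 * q)) lee_fin.
  by rewrite sumr_const prodr_const !card_ord.
apply: le_trans (lee_sum _ (fun g _ => bound g)) _.
by rewrite sumEFin lee_fin sumr_const -[leLHS]mulr_natl.
Qed.

End hits.

(** * Grid covering and the deterministic count of hits *)

(** Take [a] to be the integer part of [(x + r) / (2 w)]; the strict bound on [r] gives [a < m] even
    at [x = r]. *)
Lemma grid_cover {R : realType} (r w x : R) (m : nat) :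
  0 < w -> `|x| <= r -> r < m%:R * w ->
  exists a : 'I_m, `|x - (- r + (2 * a%:R + 1) * w)| <= w.
Proof.
move=> w0 /ler_normlP[xr1 xr2] rm.
have u0 : 0 <= (x + r) / (2 * w) by apply: divr_ge0; lra.
have /andP[] := truncn_itv u0; set a := Num.trunc _.
rewrite ler_pdivlMr ?ltr_pdivrMr ?mulr_gt0// -natr1 => a1 a2.
have am : (a < m)%N.
  rewrite -(ltr_nat R) -(ltr_pM2r w0).
  by rewrite mulrCA in a1; lra.
exists (Ordinal am) => /=; rewrite ler_distl; apply/andP; split; lra.
Qed.

(* If fewer than half of the [i] had a point in [square g h], more than half
   of them would have [kmin > 2 h / 3], contradicting the bound on the sum. *)
Lemma half_hit {R : realType} (n k : nat) (k0 : (0 < k)%N)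
    (v : 'I_n * 'I_k -> R * R) (p g : R * R) (h : R) :
  0 < h -> `|p.1 - g.1| <= h / 3 -> `|p.2 - g.2| <= h / 3 ->
  \sum_(i < n) kmin k0 (fun j => dist2 (v (i, j)) p) <= n%:R * (h / 3) ->
  (n <= 2 * #|[set i : 'I_n | [exists j, v (i, j) \in square g h]]%SET|)%N.
Proof.
move=> h0 p1 p2; set H := [set i | _]%SET => sumh.
have far : #|~: H|%:R * (2 * (h / 3)) <= n%:R * (h / 3).
  apply: le_trans sumh.
  rewrite (bigID (mem H))/= -[leLHS]add0r lerD//.
    apply: sumr_ge0 => i _; have [j ->] := kmin_attained k0 (fun j => dist2 (v (i, j)) p).
    exact: dist2_ge0.
  under eq_bigl do rewrite -finset.in_setC.
  rewrite mulr_natl -sumr_const; apply: ler_sum => i.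
  rewrite !inE negb_exists => /forallP far.
  have [j ->] := kmin_attained k0 (fun j => dist2 (v (i, j)) p).
  (* A sample closer than [2 h / 3] to [p] is within [2 h / 3 + h / 3 = h] of [g] in each
     coordinate. *)
  rewrite leNgt; apply/negP => near.
  have /negP := far j; apply; rewrite inE; apply/squareP.
  have := le_dist2_fst (v (i, j)) p; have := le_dist2_snd (v (i, j)) p.
  have := ler_distD p.1 (v (i, j)).1 g.1; have := ler_distD p.2 (v (i, j)).2 g.2.
  by move=> d1 d2 e1 e2; split; lra.
have h3 : 0 < h / 3 by rewrite divr_gt0.
rewrite mulrA ler_pM2r// -natrM ler_nat in far.
by have := cardsC H; rewrite card_ord => e; lia.
Qed.

(** * Numerical comparison of the tail with the number of cells *)

(** With [v = C (kappa + 1)], [eta < t] forces [r / eta >= 3 v], so [N / 8] exceeds [9 v^2 L / 4],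
    while [M^2 <= 49 (v - 1)]. *)
Lemma grid_tail_lt {R : realType} (r C kappa t eta delta N M : R) :
  0 < r -> 1 <= kappa -> 1 <= C ->
  t * (3 * C * (kappa + 1)) <= r -> 0 < eta < t -> 0 < delta < 1 ->
  2 * r ^+ 2 / eta ^+ 2 * ln (2 / delta) < N ->
  M ^+ 2 <= 49 * (kappa * C) ->
  M ^+ 2 * expR (- (N / 8)) < delta.
Proof.
move=> r0 kappa1 C1 tr /andP[eta0 etat] /andP[delta0 delta1] hN hM.
set L := ln (2 / delta) in hN.
have eL : expR L = 2 / delta by rewrite lnK// posrE divr_gt0.
have eL2 : 2 <= expR L by rewrite eL ler_pdivlMr//; lra.
have L0 : 0 < L by rewrite -expR_gt1; lra.
have Lhalf : 2^-1 <= L.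
  have := expR_ge1Dx (- L); rewrite expRN => H.
  have : (expR L)^-1 <= 2^-1 by rewrite lef_pV2 ?posrE ?expR_gt0//.
  lra.
pose v := C * (kappa + 1).
have v2 : 2 <= v by rewrite /v; nra.
have hv : 9 * v ^+ 2 <= r ^+ 2 / eta ^+ 2.
  rewrite ler_pdivlMr ?exprn_gt0// (_ : 9 * _ * _ = (eta * (3 * v)) ^+ 2); last by ring.
  have ev0 : 0 <= eta * (3 * v) by apply: mulr_ge0; lra.
  rewrite lerXn2r ?nnegrE ?(ltW r0)//.
  rewrite (le_trans _ tr)// -[3 * C * _]mulrA -/v ler_wpM2r ?(ltW etat)//.
  lra.
(* The left factor is the tangent of [9 v^2 / 4] at [v = 2]. *)
have hN8 : L * (9 + 9 * (v - 2)) < N / 8.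
  rewrite ltr_pdivlMr//; apply: le_lt_trans hN.
  rewrite [leRHS]mulrC -[leLHS]mulrA ler_pM2l// -mulrA.
  have := sqr_ge0 (v - 2); nra.
(* Split [9 L] as [L + 8 L]: [exp (- L)] is [delta / 2], [exp (- 8 L) <= 2^-8] absorbs 49, and the
   remaining term absorbs [v - 1]. *)
have tail : expR (- (N / 8)) <
    expR (- L) * (expR (- L) ^+ 8 * (1 + (v - 2))^-1).
  apply: (@lt_le_trans _ _ (expR (- (L * (9 + 9 * (v - 2)))))).
    by rewrite ltr_expR ltrN2.
  rewrite (_ : - (L * _) = - L + (8%:R * - L + - (9 * L * (v - 2)))); last by ring.
  rewrite !expRD expRM_natl ler_pM2l ?expR_gt0//.
  rewrite ler_pM2l ?exprn_gt0 ?expR_gt0// expRN lef_pV2 ?posrE ?expR_gt0//; last lra.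
  apply: le_trans (expR_ge1Dx _); nra.
have eNL : expR (- L) <= 2^-1.
  by rewrite expRN lef_pV2 ?posrE ?expR_gt0//.
have e8 : expR (- L) ^+ 8 <= 2^-1 ^+ 8.
  by rewrite lerXn2r// nnegrE ltW// expR_gt0.
have dE : delta = 2 * expR (- L) by rewrite expRN eL invf_div; field; lra.
rewrite dE.
apply: (@le_lt_trans _ _ (49 * (v - 1) * expR (- (N / 8)))).
  rewrite ler_wpM2r ?(ltW (expR_gt0 _))// (le_trans hM)// /v; nra.
apply: (@lt_le_trans _ _ (49 * (v - 1) * (expR (- L) * (expR (- L) ^+ 8 * (1 + (v - 2))^-1)))).
  by rewrite ltr_pM2l//; lra.
rewrite (_ : 1 + (v - 2) = v - 1); last by ring.
rewrite (_ : _ * _ * _ = expR (- L) * (49 * expR (- L) ^+ 8)); last by field; lra.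
rewrite mulrC ler_pM2r ?expR_gt0//.
move: (expR (- L) ^+ 8) e8 => E; rewrite exprVn => e8.
lra.
Qed.

(** * Choice of the grid and conclusion *)

Theorem mainTheorem14 (R : realType) (d : measure_display) (T : measurableType d)
  (P : probability T R) (n k : nat) (k0 : (0 < k)%N) (Rad C0 : R)
  (f : 'I_n -> R * R -> R)
  (X Y : 'I_n -> 'I_k -> T -> R) :
  0 < Rad -> 0 < C0 ->
  (forall i j, measurable_fun setT (X i j)) ->
  (forall i j, measurable_fun setT (Y i j)) ->
  (forall i, measurable_fun setT (f i)) ->
  (* ||f_i||_{L_oo(B((0,0),R))} <= C0 *)
  (forall i, {ae @leb2 R, forall z, disk Rad z -> `|f i z| <= C0}) ->
  (* f_i = 0 outside B((0,0),R) *)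
  (forall i z, ~ disk Rad z -> f i z = 0) ->
  (* (X_{i,j}, Y_{i,j}) has density f_i *)
  (forall i j (A : set (R * R)), measurable A ->
     P ((fun w => (X i j w, Y i j w)) @^-1` A) =
     (\int[@leb2 R]_(z in A) (f i z)%:E)%E) ->
  (* all the random vectors are mutually independent *)
  mutually_independent P (fun ij : 'I_n * 'I_k =>
                            fun w => (X ij.1 ij.2 w, Y ij.1 ij.2 w)) ->
  forall eta delta : R, 0 < eta -> 0 < delta < 1 ->
  2 * Rad ^+ 2 / eta ^+ 2 * ln (2 / delta) < n%:R ->
  (P [set w | forall xy : R * R, disk Rad xy ->
        ((n%:R)^-1 * \sum_(i < n)
           kmin k0 (fun j => dist2 (X i j w, Y i j w) xy)
        >= 1 / (4 * pi * Rad * C0 * (k%:R + 1)) - eta)%R]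
    > (1 - delta)%:E)%E.
Proof.
move=> Rad0 C00 mX mY mf fC f0 fdens indep eta delta eta0 delta01 hn.
have [delta0 delta1] := andP delta01.
set t := 1 / _.
pose V (ij : 'I_n * 'I_k) w := (X ij.1 ij.2 w, Y ij.1 ij.2 w).
pose F (p : R * R) w := n%:R^-1 *
  \sum_(i < n) kmin k0 (fun j => dist2 (X i j w, Y i j w) p).
have L0 : 0 < ln (2 / delta) by rewrite ln_gt0// ltr_pdivlMr//; lra.
have n0R : 0 < n%:R :> R.
  apply: lt_trans hn; rewrite !(mulr_gt0, invr_gt0, exprn_gt0)//.
have n0 : (0 < n)%N by rewrite -(ltr0n R).
have mV ij : measurable_fun setT (V ij) by exact: measurable_fun_pair.
have lipF w p q : F q w <= F p w + (`|p.1 - q.1| + `|p.2 - q.2|).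
  rewrite /F; set e := _ + `|_|.
  rewrite -[e](mulKf (lt0r_neq0 n0R)) -mulrDr ler_pM2l ?invr_gt0//.
  rewrite mulr_natl -[X in _ *+ X](card_ord n) -sumr_const -big_split/=.
  by apply: ler_sum => i _; apply: kmin_lip => j; exact: dist2_lip.
have mF p : measurable_fun setT (F p).
  apply: measurable_funM => //; apply: measurable_sum => i.
  by apply: measurable_kmin => j; exact: measurable_dist2.
have mGood : measurable [set w | forall p, disk Rad p -> t - eta <= F p w].
  exact: measurable_forall_disk.
pose Good := [set w | forall p, disk Rad p -> t - eta <= F p w].
rewrite -/Good in mGood; change ((1 - delta)%:E < P Good)%E.
have pi3 := pi_ge3 R; have k1 : 1 <= k%:R :> R by rewrite ler1n.
(* If [t <= eta], the threshold is nonpositive and the event is certain. *)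
have [teta|etat] := leP t eta.
  rewrite (_ : Good = setT) ?probability_setT ?lte_fin; first by lra.
  apply/seteqP; split => // w _ p _ /=; apply: (@le_trans _ _ 0); first lra.
  apply: mulr_ge0; first by rewrite invr_ge0 ltW.
  apply: sumr_ge0 => i _.
  have [j ->] := kmin_attained k0 (fun j => dist2 (X i j w, Y i j w) p).
  exact: dist2_ge0.
have probV ij g (h : R) : 0 <= h ->
    (P (V ij @^-1` square g h) <= (C0 * (4 * h ^+ 2))%:E)%E.
  move=> h0; rewrite fdens; last exact: measurable_square.
  rewrite EFinM -(leb2_square g h h0).
  exact: (integral_density_le R (f ij.1) Rad C0 (square g h) (ltW C00)
    (mf _) (fC _) (f0 _) (measurable_square g h)).
pose C := 4 * C0 * Rad ^+ 2.
have C1 : 1 <= C.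
  have := probV (Ordinal n0, Ordinal k0) (0, 0) Rad (ltW Rad0).
  rewrite fdens; last exact: measurable_square.
  rewrite -(integral_density_square R _ Rad (f0 _) (ltW Rad0)).
  rewrite -(fdens _ (Ordinal k0) setT measurableT)/=.
  by rewrite preimage_setT probability_setT lee_fin /C; lra.
have kC0 : 0 < k%:R * C0 by rewrite mulr_gt0//; lra.
(* [h] is chosen so that a square of side [2 h] has mass at most 1 / (4 k). *)
pose h := (4 * Num.sqrt (k%:R * C0))^-1.
have h0 : 0 < h by rewrite invr_gt0 mulr_gt0// sqrtr_gt0.
have hE : 16 * (k%:R * C0) * h ^+ 2 = 1.
  rewrite /h exprVn exprMn sqr_sqrtr ?ltW//.
  rewrite (_ : 16 = 4 ^+ 2); last by ring.
  by rewrite divff// mulf_neq0// ?expf_neq0// lt0r_neq0.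
have tE : t * (4 * pi * Rad * C0 * (k%:R + 1)) = 1.
  by rewrite /t mul1r mulVf// !mulf_neq0//; lra.
have t0 : 0 < t by lra.
pose B := Rad * C0 * (k%:R + 1).
have B0 : 0 < B by rewrite !mulr_gt0//; lra.
have tB : t * (12 * B) <= 1.
  rewrite -[leRHS]tE ler_pM2l//.
  rewrite (_ : 4 * pi * Rad * C0 * (k%:R + 1) = 4 * pi * B); last by rewrite /B; ring.
  by rewrite ler_pM2r//; lra.
(* Compare squares: by [hE] the claim reduces to [4 k <= C (k + 1)^2], which follows from [C >= 1]
   and [(k - 1)^2 >= 0]. *)
have hB : 1 <= 4 * h * B.
  have e : k%:R * (4 * h * B) ^+ 2 = C / 4 * (k%:R + 1) ^+ 2.
    by rewrite -[RHS]mul1r -[X in _ = X * _]hE /B /C; field.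
  have hB0 : 0 <= 4 * h * B by rewrite !mulr_ge0// ltW.
  have kC : k%:R * 1 <= C / 4 * (k%:R + 1) ^+ 2.
    have : (k%:R + 1) ^+ 2 <= C * (k%:R + 1) ^+ 2 by rewrite ler_peMl// sqr_ge0.
    by have := sqr_ge0 (k%:R - 1 : R); lra.
  rewrite -e ler_pM2l// in kC; last lra.
  by move: (4 * h * B) kC hB0 => s; nra.
have th : t <= h / 3 by rewrite -(ler_pM2r B0); lra.
have tC : t * (3 * C * (k%:R + 1)) <= Rad.
  rewrite (_ : t * _ = Rad * (t * (12 * B))); last by rewrite /C /B; ring.
  by rewrite -[leRHS]mulr1 ler_pM2l.
pose m := (Num.trunc (Rad / (h / 3))).+1.
have mh : Rad < m%:R * (h / 3).
  by rewrite -ltr_pdivrMr ?divr_gt0//; exact: truncnS_gt.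
(* For [x = Rad / h >= 2], [m <= 3 x + 1 <= 7 x / 2]; hence 49, as [x^2 = 4 k C]. *)
have mC : m%:R ^+ 2 <= 49 * (k%:R * C).
  pose x := Rad / h.
  have x0 : 0 <= x by rewrite divr_ge0// ltW.
  have xE : x ^+ 2 = 4 * (k%:R * C).
    by rewrite -[LHS]mul1r -[X in X * _ = _]hE /x /C; field; lra.
  have x2 : 2 <= x by nra.
  have : m%:R <= 3 * x + 1.
    rewrite /m -[leLHS]natr1 lerD2r (_ : 3 * x = Rad / (h / 3)) ?truncn_le ?divr_ge0 ?ltW//.
    by rewrite /x; field; lra.
  have := ler0n R m; move: (m%:R) => M; nra.
pose center (ab : 'I_m * 'I_m) : R * R :=
  (- Rad + (2 * ab.1%:R + 1) * (h / 3), - Rad + (2 * ab.2%:R + 1) * (h / 3)).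
have bad : ((2 ^+ n)%:E * P (~` Good) <=
    (#|{: 'I_m * 'I_m}|%:R * (1 + 3 * (4 * k%:R)^-1 *+ k) ^+ n)%:E)%E.
  apply: (@prob_half_hit _ _ _ P n k V mV indep _ (fun ab => square (center ab) h)).
  - exact: measurableC.
  - by move=> g; exact: measurable_square.
  - move=> g ij; apply: le_trans (probV ij (center g) h (ltW h0)) _.
    rewrite lee_fin -[leRHS]div1r ler_pdivlMr; last by rewrite mulr_gt0//; lra.
    lra.
  (* A bad outcome has a point [p] with mean below [t - eta <= h / 3]; the cell containing [p] is
     the one half hit. *)
  - move=> w /existsNP[p /not_implyP[dp /negP]]; rewrite -ltNge => Fp.
    have [p1 p2] : `|p.1| <= Rad /\ `|p.2| <= Rad.
      move: dp; rewrite /disk/= => dp.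
      by rewrite !ler_norml; split; apply/andP; split; nra.
    have h3 : 0 < h / 3 by rewrite divr_gt0.
    have [a ap] := grid_cover _ _ _ _ h3 p1 mh.
    have [b bp] := grid_cover _ _ _ _ h3 p2 mh.
    exists (a, b); apply: (@half_hit _ _ _ k0 (V^~ w) p) => //=.
    rewrite mulrC -ler_pdivrMr// mulrC.
    apply: le_trans (ltW Fp) _; lra.
have tail := @grid_tail_lt R Rad C k%:R t eta delta n%:R m%:R Rad0 k1 C1 tC.
rewrite eta0 etat in tail; have {}tail := tail isT delta01 hn mC.
have mBad : measurable (~` Good) by exact: measurableC.
have PE : P (~` Good) = (fine (P (~` Good)))%:E by rewrite fineK// fin_num_measure.
have PG : P Good = (1 - fine (P (~` Good)))%:E.
  by have := probability_setC P mBad; rewrite setCK => ->; rewrite EFinB -PE.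
rewrite PG lte_fin ltrD2l ltrN2; apply: le_lt_trans tail.
move: bad; rewrite PE -EFinM lee_fin card_prod card_ord natrM -expr2.
move: (fine _) => p bad.
(* After multiplying by [2^n] it remains to see [7/4 <= 2 exp (- 1/8)], that is
   [1 - 1/8 <= exp (- 1/8)]. *)
rewrite -(ler_pM2l (exprn_gt0 n (ltr0n R 2))) (le_trans bad)//.
rewrite mulrCA ler_wpM2l ?sqr_ge0//.
rewrite (_ : - (n%:R / 8) = n%:R * - 8^-1); last by rewrite mulrN.
rewrite expRM_natl -exprMn lerXn2r ?nnegrE//.
have := expR_ge1Dx (- 8^-1 : R).
rewrite (_ : 3 * _ *+ k = 3 / 4); first by lra.
by rewrite -mulr_natr; field; lra.
Qed.
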